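(* Let $E\in\{\mathscr D_a(\mathbb R),\mathscr D(\mathbb R)\}$ (with $a>0$), $E_1=\{\xi\in E:\int_{-\infty}^\infty\xi(x)\,dx=1\}$, $U\in\mathcal N(E)$ and $\gamma\in C(0)$. Let $f\in E^{(\gamma,U)}$ be arbitrary. Then for every $\zeta\in E_1$ there are $U_\zeta\in\mathcal N(E)$ and $y_\zeta\in E^{(\gamma,U_\zeta)}$ such that $y_\zeta'=f$ and $$y_\zeta(\xi)=f\Big(-\int_{-\infty}^x\Big[\xi(\tau)-\Big(\int_{-\infty}^\infty\xi(s)\,ds\Big)\zeta(\tau)\Big]\,d\tau\Big),\qquad\forall\,\xi\in E,$$ where the argument of $f$ is the test function of the variable $x\in\mathbb R$ given by the displayed expression.
   Context: Test function spaces on $\mathbb R$, over $\mathbb C$: for $a>0$, $\mathscr D_a(\mathbb R)$ is the Fréchet space of infinitely differentiable $\xi:\mathbb R\to\mathbb C$ with $\xi(x)=0$ for $|x|>a$, with norms $\|\xi\|_p=\sup_{|x|\le a}\max_{q\le p}|\xi^{(q)}(x)|$, $p=0,1,2,\dots$; $\mathscr D(\mathbb R)=\bigcup_{m\ge1}\mathscr D_m(\mathbb R)$ is the strict inductive limit. $\mathcal N(E)$ is the family of neighborhoods of $0$ in $E$. $C(0)$ is the set of functions $\gamma:\mathbb C\to\mathbb C$ with $\lim_{t\to0}\gamma(t)=\gamma(0)=0$ and $|\gamma(t)|\ge|t|$ for $|t|\le1$. For $\gamma\in C(0)$ and $U\in\mathcal N(E)$, $E^{(\gamma,U)}$ (demi-distributions)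 is the set of continuous $f:E\to\mathbb C$ with $f(0)=0$ such that for all $x\in E$, $u\in U$ and scalars $|t|\le1$ there are scalars $r,s$ with $|r-1|\le|\gamma(t)|$, $|s|\le|\gamma(t)|$ and $f(x+tu)=rf(x)+sf(u)$. The derivative of $y\in E^{(\gamma,U)}$ is $y':E\to\mathbb C$, $y'(\xi)=y(-\xi')$. *)

(* Defs.v *)
From Stdlib Require Import Reals Lra Lia FunctionalExtensionality ProofIrrelevance.
From Coquelicot Require Import Coquelicot.

Set Implicit Arguments.
Unset Strict Implicit.
Unset Printing Implicit Defensive.

Local Open Scope R_scope.

(* Derivatives of a complex-valued function of a real variable are taken on
   real and imaginary parts; [smooth_is_derive] below checks this against
   [is_derive]. *)
Definition CDerive_n (xi : R -> C) (n : nat) (x : R) : C :=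
  (Derive_n (fun t => Re (xi t)) n x, Derive_n (fun t => Im (xi t)) n x).

Definition smooth (xi : R -> C) : Prop :=
  forall (n : nat) (x : R),
    ex_derive_n (fun t => Re (xi t)) n x /\ ex_derive_n (fun t => Im (xi t)) n x.

Lemma smooth_is_derive (xi : R -> C) (n : nat) (x : R) :
  smooth xi ->
  is_derive (V := C_R_NormedModule) (CDerive_n xi n) x (CDerive_n xi (S n) x).
Proof.
intros H.
destruct (H (S n) x) as [Hr Hi].
apply filterdiff_ext_lin with
  (fun y : R => (scal y (Derive_n (fun t => Re (xi t)) (S n) x),
                 scal y (Derive_n (fun t => Im (xi t)) (S n) x))).
- apply (filterdiff_comp_2
           (fun y : R_NormedModule => Derive_n (fun t => Re (xi t)) n y)
           (fun y : R_NormedModule => Derive_n (fun t => Im (xi t)) n y)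
           (fun u v : R_NormedModule => (u, v))).
  + apply Derive_correct; exact Hr.
  + apply Derive_correct; exact Hi.
  + apply filterdiff_ext_lin with (fun t : R * R => t).
    * apply filterdiff_ext with (fun t : R * R => t); [now intros []|].
      apply filterdiff_id.
    * now intros [].
- intros y; reflexivity.
Qed.

Definition supported_in (a : R) (xi : R -> C) : Prop :=
  smooth xi /\ forall x, a < Rabs x -> xi x = RtoC 0.

(* [D_ a] stands for the functions vanishing off [-a, a], [D_R] for all
   compactly supported ones. *)
Inductive test_space : Type :=
  | D_ (a : posreal)
  | D_R.

Definition in_space (E : test_space) (xi : R -> C) : Prop :=
  match E with
  | D_ a => supported_in a xi
  | D_R => exists m : nat, (1 <= m)%nat /\ supported_in (INR m) xi
  end.

Record test (E : test_space) : Type := Test {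
  test_fun :> R -> C;
  test_prop : in_space E test_fun
}.

Lemma test_ext (E : test_space) (xi eta : test E) :
  (forall x, xi x = eta x) -> xi = eta.
Proof.
destruct xi as [f Hf], eta as [g Hg]; simpl; intros H.
assert (e : f = g) by (apply functional_extensionality; exact H).
subst g; f_equal; apply proof_irrelevance.
Qed.

Lemma smooth_zero : smooth (fun _ => RtoC 0).
Proof. intros n x; split; apply ex_derive_n_const. Qed.

Lemma smooth_plus xi eta :
  smooth xi -> smooth eta -> smooth (fun x => (xi x + eta x)%C).
Proof.
intros Hx He n x; split.
- apply (ex_derive_n_plus (fun t => Re (xi t)) (fun t => Re (eta t)));
    apply filter_forall; intros y k _; [apply Hx | apply He].
- apply (ex_derive_n_plus (fun t => Im (xi t)) (fun t => Im (eta t)));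
    apply filter_forall; intros y k _; [apply Hx | apply He].
Qed.

Lemma smooth_scal (c : C) xi : smooth xi -> smooth (fun x => (c * xi x)%C).
Proof.
intros Hx n x; split.
- apply (ex_derive_n_minus (fun t => fst c * Re (xi t)) (fun t => snd c * Im (xi t)));
    apply filter_forall; intros y k _; apply ex_derive_n_scal_l; apply Hx.
- apply (ex_derive_n_plus (fun t => fst c * Im (xi t)) (fun t => snd c * Re (xi t)));
    apply filter_forall; intros y k _; apply ex_derive_n_scal_l; apply Hx.
Qed.

Lemma smooth_Derive xi : smooth xi -> smooth (CDerive_n xi 1).
Proof.
intros Hx n x.
assert (K : forall (g : R -> R), (forall k y, ex_derive_n g k y) ->
              ex_derive_n (Derive_n g 1) n x).
{ intros g Hg; destruct n as [|n]; [exact I|].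
  simpl.
  apply ex_derive_ext with (Derive_n g (S n)); [|apply (Hg (S (S n)))].
  intros t.
  rewrite <- (Nat.add_1_r n), <- (Derive_n_comp g n 1 t); reflexivity. }
split.
- apply (K (fun t => Re (xi t))); intros k y; apply Hx.
- apply (K (fun t => Im (xi t))); intros k y; apply Hx.
Qed.

Lemma supported_in_le a b xi : a <= b -> supported_in a xi -> supported_in b xi.
Proof. intros Hab [Hs Hz]; split; [exact Hs|]; intros x Hx; apply Hz; lra. Qed.

Lemma supported_in_zero a : supported_in a (fun _ => RtoC 0).
Proof. split; [apply smooth_zero | reflexivity]. Qed.

Lemma supported_in_plus a xi eta :
  supported_in a xi -> supported_in a eta ->
  supported_in a (fun x => (xi x + eta x)%C).
Proof.
intros [Hx Zx] [He Ze]; split; [now apply smooth_plus|].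
intros x H; rewrite Zx, Ze by exact H; ring.
Qed.

Lemma supported_in_scal a c xi :
  supported_in a xi -> supported_in a (fun x => (c * xi x)%C).
Proof.
intros [Hx Zx]; split; [now apply smooth_scal|].
intros x H; rewrite Zx by exact H; ring.
Qed.

Lemma supported_in_Derive a xi :
  supported_in a xi -> supported_in a (CDerive_n xi 1).
Proof.
intros [Hx Zx]; split; [now apply smooth_Derive|].
intros x H.
assert (L : locally x (fun y => a < Rabs y)).
{ apply (continuous_comp Rabs (fun y => y) x).
  - apply continuous_Rabs.
  - apply continuous_id.
  - apply (open_gt a); exact H. }
unfold CDerive_n, RtoC; simpl; f_equal.
- rewrite (Derive_ext_loc _ (fun _ => 0)); [apply Derive_const|].
  apply filter_imp with (2 := L); intros y Hy; rewrite Zx by exact Hy; reflexivity.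
- rewrite (Derive_ext_loc _ (fun _ => 0)); [apply Derive_const|].
  apply filter_imp with (2 := L); intros y Hy; rewrite Zx by exact Hy; reflexivity.
Qed.

Lemma in_space_zero E : in_space E (fun _ => RtoC 0).
Proof.
destruct E as [a|]; simpl.
- apply supported_in_zero.
- exists 1%nat; split; [lia | apply supported_in_zero].
Qed.

Lemma in_space_plus E xi eta :
  in_space E xi -> in_space E eta -> in_space E (fun x => (xi x + eta x)%C).
Proof.
destruct E as [a|]; simpl.
- apply supported_in_plus.
- intros [m [Hm H]] [k [Hk K]]; exists (Nat.max m k); split; [lia|].
  apply supported_in_plus.
  + apply supported_in_le with (2 := H); apply le_INR; lia.
  + apply supported_in_le with (2 := K); apply le_INR; lia.
Qed.

Lemma in_space_scal E c xi :
  in_space E xi -> in_space E (fun x => (c * xi x)%C).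
Proof.
destruct E as [a|]; simpl.
- apply supported_in_scal.
- intros [m [Hm H]]; exists m; split; [exact Hm | now apply supported_in_scal].
Qed.

Lemma in_space_Derive E xi : in_space E xi -> in_space E (CDerive_n xi 1).
Proof.
destruct E as [a|]; simpl.
- apply supported_in_Derive.
- intros [m [Hm H]]; exists m; split; [exact Hm | now apply supported_in_Derive].
Qed.

Definition test_zero E : test E := Test (in_space_zero E).
Definition test_plus E (xi eta : test E) : test E :=
  Test (in_space_plus (test_prop xi) (test_prop eta)).
Definition test_scal E (c : C) (xi : test E) : test E :=
  Test (in_space_scal c (test_prop xi)).
Definition test_opp E (xi : test E) : test E := test_scal (RtoC (-1)) xi.
Definition test_deriv E (xi : test E) : test E :=
  Test (in_space_Derive (test_prop xi)).

Section TestModule.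

Variable E : test_space.

Lemma test_plus_comm (x y : test E) : test_plus x y = test_plus y x.
Proof. apply test_ext; intros t; simpl; ring. Qed.
Lemma test_plus_assoc (x y z : test E) :
  test_plus x (test_plus y z) = test_plus (test_plus x y) z.
Proof. apply test_ext; intros t; simpl; ring. Qed.
Lemma test_plus_zero (x : test E) : test_plus x (test_zero E) = x.
Proof. apply test_ext; intros t; simpl; ring. Qed.
Lemma test_plus_opp (x : test E) : test_plus x (test_opp x) = test_zero E.
Proof. apply test_ext; intros t; apply injective_projections; simpl; ring. Qed.

Definition test_AbelianMonoid_mixin :=
  AbelianMonoid.Mixin (test E) (@test_plus E) (test_zero E)
    test_plus_comm test_plus_assoc test_plus_zero.
Canonical test_AbelianMonoid :=
  AbelianMonoid.Pack (test E) test_AbelianMonoid_mixin (test E).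

Definition test_AbelianGroup_mixin :=
  AbelianGroup.Mixin test_AbelianMonoid (@test_opp E) test_plus_opp.
Canonical test_AbelianGroup :=
  AbelianGroup.Pack (test E)
    (AbelianGroup.Class (test E) test_AbelianMonoid_mixin test_AbelianGroup_mixin)
    (test E).

Lemma test_scal_assoc (c d : C_Ring) (x : test E) :
  test_scal c (test_scal d x) = test_scal (mult c d) x.
Proof. apply test_ext; intros t; unfold mult; simpl; ring. Qed.
Lemma test_scal_one (x : test E) : test_scal (one : C_Ring) x = x.
Proof. apply test_ext; intros t; unfold one; simpl; ring. Qed.
Lemma test_scal_plus_r (c : C_Ring) (x y : test E) :
  test_scal c (plus x y) = plus (test_scal c x) (test_scal c y).
Proof. apply test_ext; intros t; unfold plus; simpl; ring. Qed.
Lemma test_scal_plus_l (c d : C_Ring) (x : test E) :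
  test_scal (plus c d) x = plus (test_scal c x) (test_scal d x).
Proof. apply test_ext; intros t; unfold plus; simpl; ring. Qed.

Definition test_ModuleSpace_mixin :=
  ModuleSpace.Mixin C_Ring test_AbelianGroup (@test_scal E)
    test_scal_assoc test_scal_one test_scal_plus_r test_scal_plus_l.
Canonical test_ModuleSpace :=
  ModuleSpace.Pack C_Ring (test E)
    (ModuleSpace.Class C_Ring (test E)
       (AbelianGroup.class test_AbelianGroup) test_ModuleSpace_mixin)
    (test E).

End TestModule.

(* The norm of order [p] on the functions supported in [-a, a]. It is finite
   for smooth functions; [Rbar] spares a proof of this. *)
Definition sup_norm (a : R) (p : nat) (xi : R -> C) : Rbar :=
  Lub_Rbar (fun r => exists (x : R) (q : nat),
    Rabs x <= a /\ (q <= p)%nat /\ r = Cmod (CDerive_n xi q x)).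

(* The trace of [V] on the space of functions supported in [-a, a] is a
   neighborhood of 0 for the norms [sup_norm a p]. These norms increase with
   [p], so that their balls form a base at 0. *)
Definition trace_nbhd0 (E : test_space) (a : R) (V : test E -> Prop) : Prop :=
  exists (p : nat) (eps : posreal),
    forall xi : test E,
      supported_in a xi -> Rbar_lt (sup_norm a p xi) eps -> V xi.

Definition absolutely_convex (E : test_space) (W : test E -> Prop) : Prop :=
  forall (xi eta : test E) (alpha beta : C),
    W xi -> W eta -> Cmod alpha + Cmod beta <= 1 ->
    W (plus (scal alpha xi) (scal beta eta)).

(* For [D_R] this is the locally convex inductive limit topology: the finest
   locally convex one making every inclusion of [D_ m] continuous. *)
Definition nbhd0 (E : test_space) : (test E -> Prop) -> Prop :=
  match E return (test E -> Prop) -> Prop with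
  | D_ a => fun V => trace_nbhd0 a V
  | D_R => fun V =>
      exists W : test D_R -> Prop,
        (forall xi, W xi -> V xi) /\
        absolutely_convex W /\
        forall m : nat, (1 <= m)%nat -> trace_nbhd0 (INR m) W
  end.

Definition nbhd (E : test_space) (x : test E) (V : test E -> Prop) : Prop :=
  nbhd0 (fun u : test E => V (plus x u)).

Definition test_continuous (E : test_space) (f : test E -> C) : Prop :=
  forall x : test E, filterlim f (nbhd x) (locally (f x)).

Definition C0 (gamma : C -> C) : Prop :=
  filterlim gamma (locally' (RtoC 0)) (locally (gamma (RtoC 0))) /\
  gamma (RtoC 0) = RtoC 0 /\
  forall t : C, Cmod t <= 1 -> Cmod t <= Cmod (gamma t).

Definition demi_distribution (E : test_space) (gamma : C -> C)
    (U : test E -> Prop) (f : test E -> C) : Prop :=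
  test_continuous f /\
  f zero = RtoC 0 /\
  forall (x u : test E) (t : C), U u -> Cmod t <= 1 ->
    exists r s : C,
      Cmod (r - RtoC 1)%C <= Cmod (gamma t) /\
      Cmod s <= Cmod (gamma t) /\
      f (plus x (scal t u)) = (r * f x + s * f u)%C.

Definition demi_derivative (E : test_space) (y : test E -> C) : test E -> C :=
  fun xi => y (opp (test_deriv xi)).

Definition integral_R (g : R -> C) : C :=
  RInt_gen (V := C_R_CompleteNormedModule) g
    (Rbar_locally m_infty) (Rbar_locally p_infty).

Definition integral_upto (g : R -> C) (x : R) : C :=
  RInt_gen (V := C_R_CompleteNormedModule) g
    (Rbar_locally m_infty) (at_point x).

(* Main.v *)
Require Import Defs.
From Stdlib Require Import Reals Lra Lia FunctionalExtensionality.
From Coquelicot Require Import Coquelicot.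

Local Open Scope R_scope.

(** Subtracting from [xi] the multiple of [zeta] that has the same integral
    leaves a test function of integral 0, and a test function of integral 0 is
    the derivative of a test function: its primitive from -oo vanishes to the
    right of the support as well as to the left. Call [T xi] the opposite of
    this primitive. Since the integral of [- xi'] is 0, nothing is subtracted
    from it, and [T (- xi') = xi]; hence [y := f o T] satisfies [y' = f] and
    the displayed formula.

    The map [T] is linear, so that [f o T] inherits the demi-linearity of [f],
    with the neighborhood [U] replaced by its preimage under [T] and with the
    same [r] and [s] ([demi_distribution_comp]). What remains is the continuity
    of [T] at 0 ([nbhd0_neg_primitive]). It follows from the estimate
    [neg_primitive_bounded]: on functions supported in a common interval
    [-k, k], the norm of order [p] of [T xi] is at most a constant times that of
    [xi], because differentiating [T xi] gives back [xi] and [zeta] while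
    integration costs a factor [2 k]. For the inductive limit, the preimage of
    an absolutely convex set under [T] is absolutely convex, and [T] maps the
    functions supported in [-m, m] to functions supported in [-k, k] as soon as
    [k >= m] and [zeta] is supported there, which reduces the continuity to
    the same estimate. *)

(** * Derivatives of smooth functions *)

(** Links the integral estimates, stated for the product norm of the real
    normed module of complex numbers, to the modulus used in [sup_norm]. *)
Lemma C_R_norm (c : C) : norm (V := C_R_NormedModule) c = Cmod c.
Proof.
unfold norm; simpl; unfold prod_norm, Cmod, norm; simpl; unfold abs; simpl.
f_equal; rewrite !Rmult_1_r, <- !Rabs_mult.
rewrite !Rabs_pos_eq; [reflexivity | apply Rle_0_sqr | apply Rle_0_sqr].
Qed.

Lemma CDerive_n_0 (g : R -> C) (x : R) : CDerive_n g 0 x = g x.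
Proof. unfold CDerive_n; simpl; now destruct (g x). Qed.

Lemma smooth_continuous (g : R -> C) (n : nat) (x : R) :
  smooth g -> continuous (U := C_R_NormedModule) (CDerive_n g n) x.
Proof.
intros Hg; apply (ex_derive_continuous (V := C_R_NormedModule)).
exists (CDerive_n g (S n) x); now apply smooth_is_derive.
Qed.

Lemma supported_in_minus_scal (a : R) (c : C) (g h : R -> C) :
  supported_in a g -> supported_in a h ->
  supported_in a (fun t => (g t - c * h t)%C).
Proof.
intros Hg Hh.
replace (fun t => (g t - c * h t)%C) with (fun t => (g t + - c * h t)%C)
  by (apply functional_extensionality; intros t; ring).
apply supported_in_plus; [exact Hg | now apply supported_in_scal].
Qed.

Lemma CDerive_n_minus_scal (c : C) (g h : R -> C) (n : nat) (x : R) :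
  smooth g -> smooth h ->
  CDerive_n (fun t => (g t - c * h t)%C) n x
  = (CDerive_n g n x - c * CDerive_n h n x)%C.
Proof.
intros Hg Hh.
pose proof (smooth_scal c Hh) as Hch.
unfold CDerive_n; apply injective_projections; simpl.
- rewrite (Derive_n_minus (fun t => Re (g t)) (fun t => Re (c * h t)%C));
    try (apply filter_forall; intros y k _; first [apply Hg | apply Hch]).
  unfold Rminus; f_equal; f_equal.
  unfold Cmult, Re; simpl.
  rewrite (Derive_n_minus (fun t => fst c * Re (h t)) (fun t => snd c * Im (h t)));
    try (apply filter_forall; intros y k _; apply ex_derive_n_scal_l; apply Hh).
  rewrite !Derive_n_scal_l; reflexivity.
- rewrite (Derive_n_minus (fun t => Im (g t)) (fun t => Im (c * h t)%C));
    try (apply filter_forall; intros y k _; first [apply Hg | apply Hch]).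
  unfold Rminus; f_equal; f_equal.
  unfold Cmult, Im; simpl.
  rewrite (Derive_n_plus (fun t => fst c * Im (h t)) (fun t => snd c * Re (h t)));
    try (apply filter_forall; intros y k _; apply ex_derive_n_scal_l; apply Hh).
  rewrite !Derive_n_scal_l; reflexivity.
Qed.

Lemma supported_in_Derive_n (a : R) (g : R -> C) (n : nat) (x : R) :
  supported_in a g -> a < Rabs x -> CDerive_n g n x = RtoC 0.
Proof.
intros [Hg Zg] Hx.
assert (L : locally x (fun y => a < Rabs y)).
{ apply (continuous_Rabs x), (open_gt a); exact Hx. }
assert (Z : forall y, Derive_n (fun _ => 0) n y = 0).
{ intros y; destruct n as [|n]; [reflexivity | apply Derive_n_const]. }
unfold CDerive_n, RtoC; f_equal;
  (rewrite (Derive_n_ext_loc _ (fun _ => 0)); [apply Z|]);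
  apply filter_imp with (2 := L); intros y Hy; rewrite Zg by exact Hy; reflexivity.
Qed.

(** * Integrals of compactly supported functions *)

Lemma is_RInt_vanishing (g : R -> C) (a b : R) :
  (forall t, Rmin a b < t < Rmax a b -> g t = RtoC 0) ->
  is_RInt (V := C_R_NormedModule) g a b (RtoC 0).
Proof.
intros H.
apply is_RInt_ext with (fun _ => RtoC 0); [intros t Ht; symmetry; now apply H|].
pose proof (is_RInt_const (V := C_R_NormedModule) a b (RtoC 0)) as K.
assert (Z : scal (V := C_R_NormedModule) (b - a) (RtoC 0) = RtoC 0)
  by apply (scal_zero_r (V := C_R_NormedModule)).
exact (eq_ind _ (is_RInt (V := C_R_NormedModule) (fun _ => RtoC 0) a b) K _ Z).
Qed.

(** The complex numbers are here a module over the reals, so that linearity for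
    a complex factor has to be read off from the real and imaginary parts. *)
Lemma is_RInt_Cscal (c : C) (g : R -> C) (a b : R) (l : C) :
  is_RInt (V := C_R_NormedModule) g a b l ->
  is_RInt (V := C_R_NormedModule) (fun t => (c * g t)%C) a b (c * l)%C.
Proof.
intros H.
pose proof (is_RInt_fct_extend_fst (U := R_NormedModule) (V := R_NormedModule) _ _ _ _ H) as H1.
pose proof (is_RInt_fct_extend_snd (U := R_NormedModule) (V := R_NormedModule) _ _ _ _ H) as H2.
apply (is_RInt_fct_extend_pair (U := R_NormedModule) (V := R_NormedModule)).
- apply (is_RInt_minus (V := R_NormedModule)); now apply (is_RInt_scal (V := R_NormedModule)).
- apply (is_RInt_plus (V := R_NormedModule)); now apply (is_RInt_scal (V := R_NormedModule)).
Qed.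

Lemma smooth_ex_RInt (g : R -> C) (a b : R) :
  smooth g -> ex_RInt (V := C_R_NormedModule) g a b.
Proof.
intros Hg; apply (ex_RInt_continuous (V := C_R_CompleteNormedModule)).
intros z _; apply (continuous_ext (CDerive_n g 0)).
- intros t; apply CDerive_n_0.
- now apply smooth_continuous.
Qed.

(** The improper integral is a proper one: below [- k] there is nothing to
    integrate, so any [s <= - k] can replace -oo. *)
Lemma is_RInt_integral_upto (k s x : R) (g : R -> C) :
  supported_in k g -> s <= - k ->
  is_RInt (V := C_R_NormedModule) g s x (integral_upto g x).
Proof.
intros [Hg Zg].
destruct (smooth_ex_RInt g (- k) x Hg) as [l Hl].
assert (K : forall r, r <= - k -> is_RInt (V := C_R_NormedModule) g r x l).
{ intros r Hr.
  replace l with (RtoC 0 + l)%C by apply Cplus_0_l.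
  apply (is_RInt_Chasles (V := C_R_NormedModule)) with (- k); [|exact Hl].
  apply is_RInt_vanishing; rewrite Rmin_left, Rmax_right by exact Hr.
  intros t Ht; apply Zg; pose proof (Rabs_maj2 t); lra. }
replace (integral_upto g x) with l; [now apply K|].
symmetry; unfold integral_upto.
apply (is_RInt_gen_unique (V := C_R_CompleteNormedModule)
  (Fa := Rbar_locally m_infty) (Fb := at_point x) g l).
intros P HP.
apply Filter_prod with (fun r => r < - k) (fun y => y = x).
- now exists (- k).
- reflexivity.
- intros r y Hr ->; exists l; split; [apply K; simpl; lra | now apply locally_singleton].
Qed.

(** Treats the full integral as a value of the primitive, so that one
    uniqueness argument gives the linearity of both. *)
Lemma integral_R_upto (k x : R) (g : R -> C) :
  supported_in k g -> k <= x -> integral_R g = integral_upto g x.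
Proof.
intros Hg Hx.
apply (is_RInt_gen_unique (V := C_R_CompleteNormedModule)
  (Fa := Rbar_locally m_infty) (Fb := Rbar_locally p_infty) g (integral_upto g x)).
intros P HP.
apply Filter_prod with (fun r => r < - k) (fun y => x < y).
- now exists (- k).
- now exists x.
- intros r y Hr Hy; exists (integral_upto g x); split; [|now apply locally_singleton].
  replace (integral_upto g x) with (integral_upto g x + RtoC 0)%C by apply Cplus_0_r.
  apply (is_RInt_Chasles (V := C_R_NormedModule)) with x.
  + apply is_RInt_integral_upto with k; [exact Hg | simpl; lra].
  + simpl; apply is_RInt_vanishing; rewrite Rmin_left, Rmax_right by lra.
    intros t Ht; apply (proj2 Hg); pose proof (Rle_abs t); lra.
Qed.

Lemma integral_upto_unique (k x : R) (g : R -> C) (l : C) :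
  supported_in k g -> is_RInt (V := C_R_NormedModule) g (- k) x l ->
  integral_upto g x = l.
Proof.
intros Hg Hl.
rewrite <- (is_RInt_unique (V := C_R_CompleteNormedModule) _ _ _ _ Hl).
symmetry; apply (is_RInt_unique (V := C_R_CompleteNormedModule)).
apply is_RInt_integral_upto with k; [exact Hg | lra].
Qed.

Lemma integral_upto_plus (k x : R) (g h : R -> C) :
  supported_in k g -> supported_in k h ->
  integral_upto (fun t => (g t + h t)%C) x
  = (integral_upto g x + integral_upto h x)%C.
Proof.
intros Hg Hh; apply integral_upto_unique with k; [now apply supported_in_plus|].
apply (is_RInt_plus (V := C_R_NormedModule));
  apply is_RInt_integral_upto with k; solve [assumption | lra].
Qed.

Lemma integral_upto_scal (k x : R) (c : C) (g : R -> C) :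
  supported_in k g ->
  integral_upto (fun t => (c * g t)%C) x = (c * integral_upto g x)%C.
Proof.
intros Hg; apply integral_upto_unique with k; [now apply supported_in_scal|].
apply is_RInt_Cscal; apply is_RInt_integral_upto with k; solve [assumption | lra].
Qed.

Lemma integral_upto_minus_scal (k x : R) (c : C) (g h : R -> C) :
  supported_in k g -> supported_in k h ->
  integral_upto (fun t => (g t - c * h t)%C) x
  = (integral_upto g x - c * integral_upto h x)%C.
Proof.
intros Hg Hh.
replace (fun t => (g t - c * h t)%C) with (fun t => (g t + - c * h t)%C)
  by (apply functional_extensionality; intros t; ring).
rewrite (integral_upto_plus k x g (fun t => (- c * h t)%C) Hg (supported_in_scal (- c) Hh)).
rewrite (integral_upto_scal k x (- c) h Hh); ring.
Qed.

(** The fundamental theorem of calculus, with no boundary term because [g]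
    vanishes at the lower end. *)
Lemma integral_upto_Derive (k x : R) (g : R -> C) :
  supported_in k g -> integral_upto (CDerive_n g 1) x = g x.
Proof.
(* [supported_in] speaks of points strictly outside [-k, k], so the lower end
   of integration is taken beyond [- k]. *)
intros Hg; apply integral_upto_unique with (k + 1).
{ apply supported_in_Derive, supported_in_le with k; [lra | exact Hg]. }
replace (g x) with (minus (CDerive_n g 0 x : C_R_NormedModule) (CDerive_n g 0 (- (k + 1)))).
- apply (is_RInt_derive (V := C_R_CompleteNormedModule)); intros t _.
  + now apply smooth_is_derive, Hg.
  + now apply smooth_continuous, Hg.
- rewrite !CDerive_n_0, (proj2 Hg (- (k + 1))); [|pose proof (Rabs_maj2 (-(k+1))); lra].
  apply (minus_zero_r (G := C_R_NormedModule)).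
Qed.

Lemma Derive_n_antiderivative (F g : R -> R) (n : nat) (x : R) :
  (forall t, is_derive F t (g t)) ->
  Derive_n F (S n) x = Derive_n g n x /\
  (ex_derive_n g n x -> ex_derive_n F (S n) x).
Proof.
intros H.
assert (E : forall m t, Derive_n F (S m) t = Derive_n g m t).
{ intros m t; rewrite <- Nat.add_1_r, <- Derive_n_comp.
  apply Derive_n_ext; intros u; now apply is_derive_unique. }
split; [apply E|].
destruct n as [|n]; intros K.
- exists (g x); apply H.
- apply ex_derive_ext with (2 := K); intros t; symmetry; apply E.
Qed.

(** * The primitive of the mean-free part *)

Definition mean_free (zeta xi : R -> C) (tau : R) : C :=
  (xi tau - integral_R xi * zeta tau)%C.

(** The sign cancels the one in [y' xi = y (- xi')]. *)
Definition neg_primitive (zeta xi : R -> C) (x : R) : C :=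
  (- integral_upto (mean_free zeta xi) x)%C.

Lemma is_derive_neg_integral_upto (k x : R) (g : R -> C) :
  supported_in k g ->
  is_derive (fun t => Re (- integral_upto g t)%C) x (- Re (g x)) /\
  is_derive (fun t => Im (- integral_upto g t)%C) x (- Im (g x)).
Proof.
intros Hg; split; apply (is_derive_opp (V := R_NormedModule)).
- apply (is_derive_RInt (V := R_NormedModule) (fun t => Re (g t))) with (- k).
  + apply filter_forall; intros b.
    apply (is_RInt_fct_extend_fst (U := R_NormedModule) (V := R_NormedModule)).
    apply is_RInt_integral_upto with k; [exact Hg | lra].
  + apply (ex_derive_continuous (V := R_NormedModule)), (proj1 Hg 1%nat x).
- apply (is_derive_RInt (V := R_NormedModule) (fun t => Im (g t))) with (- k).
  + apply filter_forall; intros b.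
    apply (is_RInt_fct_extend_snd (U := R_NormedModule) (V := R_NormedModule)).
    apply is_RInt_integral_upto with k; [exact Hg | lra].
  + apply (ex_derive_continuous (V := R_NormedModule)), (proj1 Hg 1%nat x).
Qed.

Lemma CDerive_n_neg_integral_upto (k : R) (g : R -> C) (n : nat) (x : R) :
  supported_in k g ->
  CDerive_n (fun t => (- integral_upto g t)%C) (S n) x = (- CDerive_n g n x)%C.
Proof.
intros Hg; unfold CDerive_n; apply injective_projections; cbn [fst snd].
- refine (eq_trans (proj1 (Derive_n_antiderivative _ (fun t => - Re (g t)) n x
    (fun t => proj1 (is_derive_neg_integral_upto k t g Hg)))) _).
  exact (Derive_n_opp (fun t => Re (g t)) n x).
- refine (eq_trans (proj1 (Derive_n_antiderivative _ (fun t => - Im (g t)) n x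
    (fun t => proj2 (is_derive_neg_integral_upto k t g Hg)))) _).
  exact (Derive_n_opp (fun t => Im (g t)) n x).
Qed.

Lemma smooth_neg_integral_upto (k : R) (g : R -> C) :
  supported_in k g -> smooth (fun t => (- integral_upto g t)%C).
Proof.
intros Hg [|n] x; [split; exact I|].
split.
- apply (Derive_n_antiderivative _ (fun t => - Re (g t)) n x
    (fun t => proj1 (is_derive_neg_integral_upto k t g Hg))).
  apply ex_derive_n_opp, Hg.
- apply (Derive_n_antiderivative _ (fun t => - Im (g t)) n x
    (fun t => proj2 (is_derive_neg_integral_upto k t g Hg))).
  apply ex_derive_n_opp, Hg.
Qed.

Lemma mean_free_supported (k : R) (zeta xi : R -> C) :
  supported_in k zeta -> supported_in k xi -> supported_in k (mean_free zeta xi).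
Proof. intros Hz Hx; now apply supported_in_minus_scal. Qed.

(** To the right of the support the primitive equals the total integral of
    [mean_free zeta xi], which is 0 because [zeta] has integral 1. *)
Lemma neg_primitive_supported (k : R) (zeta xi : R -> C) :
  supported_in k zeta -> integral_R zeta = RtoC 1 ->
  supported_in k xi -> supported_in k (neg_primitive zeta xi).
Proof.
intros Hz H1 Hx; pose proof (mean_free_supported k zeta xi Hz Hx) as Hm.
split; [now apply smooth_neg_integral_upto with k|].
intros x Hk; unfold neg_primitive.
destruct (Rle_or_lt 0 x) as [H0|H0].
- rewrite Rabs_pos_eq in Hk by exact H0.
  unfold mean_free; rewrite (integral_upto_minus_scal k) by assumption.
  rewrite <- (integral_R_upto k x xi Hx), <- (integral_R_upto k x zeta Hz) by lra.
  rewrite H1; ring.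
- rewrite Rabs_left in Hk by exact H0.
  assert (Z : integral_upto (mean_free zeta xi) x = RtoC 0).
  (* [x <= - k], so [x] itself can replace -oo: the interval is degenerate *)
  { rewrite <- (is_RInt_unique (V := C_R_CompleteNormedModule) _ x x _
      (is_RInt_integral_upto k x x _ Hm ltac:(lra))).
    apply (RInt_point (V := C_R_CompleteNormedModule)). }
  rewrite Z; ring.
Qed.

Lemma neg_primitive_in_space (E : test_space) (zeta xi : test E) :
  integral_R zeta = RtoC 1 -> in_space E (neg_primitive zeta xi).
Proof.
destruct zeta as [z Hz], xi as [x Hx]; simpl; intros H1.
destruct E as [a|]; simpl in *.
- now apply neg_primitive_supported.
- destruct Hz as [m [Hm Sm]], Hx as [n [Hn Sn]].
  exists (Nat.max m n); split; [lia|].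
  apply neg_primitive_supported; [|exact H1|].
  + apply supported_in_le with (2 := Sm); apply le_INR; lia.
  + apply supported_in_le with (2 := Sn); apply le_INR; lia.
Qed.

Lemma common_support (E : test_space) (xi eta : test E) :
  exists k, supported_in k xi /\ supported_in k eta.
Proof.
destruct xi as [x Hx], eta as [y Hy]; simpl; destruct E as [a|]; simpl in *.
- now exists a.
- destruct Hx as [m [_ Sm]], Hy as [n [_ Sn]]; exists (Rmax (INR m) (INR n)); split.
  + apply supported_in_le with (2 := Sm); apply Rmax_l.
  + apply supported_in_le with (2 := Sn); apply Rmax_r.
Qed.

(** Separates [xi] from [zeta], so that the linearity in [xi] is that of the two
    integrals. *)
Lemma neg_primitive_integral_upto (k x : R) (zeta xi : R -> C) :
  supported_in k zeta -> supported_in k xi ->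
  neg_primitive zeta xi x
  = (integral_R xi * integral_upto zeta x - integral_upto xi x)%C.
Proof.
intros Hz Hx; unfold neg_primitive, mean_free.
rewrite (integral_upto_minus_scal k x (integral_R xi) xi zeta Hx Hz); ring.
Qed.

Lemma neg_primitive_plus (k x : R) (zeta xi eta : R -> C) :
  supported_in k zeta -> supported_in k xi -> supported_in k eta ->
  neg_primitive zeta (fun t => (xi t + eta t)%C) x
  = (neg_primitive zeta xi x + neg_primitive zeta eta x)%C.
Proof.
intros Hz Hx He; pose proof (supported_in_plus Hx He) as Hs.
rewrite (neg_primitive_integral_upto k x zeta _ Hz Hs).
rewrite (neg_primitive_integral_upto k x zeta xi Hz Hx).
rewrite (neg_primitive_integral_upto k x zeta eta Hz He).
rewrite (integral_R_upto k k _ Hs (Rle_refl k)), (integral_R_upto k k xi Hx (Rle_refl k)),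
  (integral_R_upto k k eta He (Rle_refl k)).
rewrite !(integral_upto_plus k _ xi eta Hx He); ring.
Qed.

Lemma neg_primitive_scal (k x : R) (c : C) (zeta xi : R -> C) :
  supported_in k zeta -> supported_in k xi ->
  neg_primitive zeta (fun t => (c * xi t)%C) x = (c * neg_primitive zeta xi x)%C.
Proof.
intros Hz Hx; pose proof (supported_in_scal c Hx) as Hs.
rewrite (neg_primitive_integral_upto k x zeta _ Hz Hs).
rewrite (neg_primitive_integral_upto k x zeta xi Hz Hx).
rewrite (integral_R_upto k k _ Hs (Rle_refl k)), (integral_R_upto k k xi Hx (Rle_refl k)).
rewrite !(integral_upto_scal k _ c xi Hx); ring.
Qed.

(** A derivative has integral 0, hence is its own mean-free part. *)
Lemma neg_primitive_opp_Derive (k x : R) (zeta xi : R -> C) :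
  supported_in k zeta -> supported_in k xi ->
  neg_primitive zeta (fun t => (RtoC (-1) * CDerive_n xi 1 t)%C) x = xi x.
Proof.
intros Hz Hx; pose proof (supported_in_Derive Hx) as Hd.
rewrite (neg_primitive_scal k x (RtoC (-1)) zeta (CDerive_n xi 1) Hz Hd).
rewrite (neg_primitive_integral_upto k x zeta (CDerive_n xi 1) Hz Hd).
assert (HI : integral_R (CDerive_n xi 1) = RtoC 0).
{ rewrite (integral_R_upto k (Rabs k + 1)) by (assumption || (pose proof (Rle_abs k); lra)).
  rewrite (integral_upto_Derive k) by assumption.
  apply (proj2 Hx); pose proof (Rle_abs k).
  pose proof (Rle_abs (Rabs k + 1)); lra. }
rewrite HI, (integral_upto_Derive k) by assumption.
apply injective_projections; simpl; ring.
Qed.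

(** * Continuity of the primitive *)

(** Replaces bounds on the [Rbar]-valued [sup_norm] by bounds on real numbers,
    see [sup_norm_le]. *)
Definition derivatives_bounded (k : R) (p : nat) (xi : R -> C) (M : R) : Prop :=
  forall (x : R) (q : nat), Rabs x <= k -> (q <= p)%nat -> Cmod (CDerive_n xi q x) <= M.

Lemma sup_norm_le (k : R) (p : nat) (xi : R -> C) (M : R) :
  Rbar_le (sup_norm k p xi) M <-> derivatives_bounded k p xi M.
Proof.
unfold sup_norm; split.
- intros H x q Hx Hq.
  change (Rbar_le (Cmod (CDerive_n xi q x)) M).
  apply Rbar_le_trans with (2 := H).
  apply (proj1 (Lub_Rbar_correct _)); now exists x, q.
- intros H; apply (proj2 (Lub_Rbar_correct _)).
  intros r [x [q [Hx [Hq ->]]]]; now apply H.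
Qed.

Lemma smooth_derivatives_bounded (k : R) (p : nat) (xi : R -> C) :
  smooth xi -> exists M, 0 < M /\ derivatives_bounded k p xi M.
Proof.
intros Hx; induction p as [|p [M [HM IH]]].
- destruct (bounded_continuity (V := C_R_NormedModule) (CDerive_n xi 0) (- k) k) as [N HN].
  { intros x _; now apply smooth_continuous. }
  exists (Rmax 1 N); split; [pose proof (Rmax_l 1 N); lra|].
  intros x q Hxk Hq; replace q with 0%nat by lia.
  apply Rle_trans with (2 := Rmax_r 1 N).
  rewrite <- C_R_norm; apply Rlt_le, HN; now apply Rabs_le_between.
- destruct (bounded_continuity (V := C_R_NormedModule) (CDerive_n xi (S p)) (- k) k) as [N HN].
  { intros x _; now apply smooth_continuous. }
  exists (Rmax M N); split; [pose proof (Rmax_l M N); lra|].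
  intros x q Hxk Hq; destruct (Nat.eq_dec q (S p)) as [->|Hne].
  + apply Rle_trans with (2 := Rmax_r M N).
    rewrite <- C_R_norm; apply Rlt_le, HN; now apply Rabs_le_between.
  + apply Rle_trans with (2 := Rmax_l M N); apply IH; [exact Hxk | lia].
Qed.

Lemma Cmod_integral_upto_le (k x M : R) (g : R -> C) :
  supported_in k g -> Rabs x <= k -> derivatives_bounded k 0 g M ->
  Cmod (integral_upto g x) <= 2 * k * M.
Proof.
intros Hg Hx HM; apply Rabs_le_between in Hx.
assert (M0 : 0 <= M).
{ apply Rle_trans with (1 := Cmod_ge_0 (CDerive_n g 0 0)), HM; [rewrite Rabs_R0; lra | lia]. }
assert (H : norm (V := C_R_NormedModule) (integral_upto g x) <= (x - - k) * M).
{ apply (norm_RInt_le_const (V := C_R_NormedModule) g (- k) x); [lra| |].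
  - intros t Ht; rewrite C_R_norm.
    rewrite <- CDerive_n_0.
    apply HM; [apply Rabs_le; lra | lia].
  - apply is_RInt_integral_upto with k; [exact Hg | lra]. }
rewrite C_R_norm in H; nra.
Qed.

(** With [N] a bound for the derivatives of [zeta], the integral of [xi] is at
    most [2 k M], so the derivatives of the mean-free part are at most
    [(1 + 2 k N) M]. Those of order at least 1 of the primitive are, up to sign,
    among them, and the primitive itself costs one more factor [2 k]. *)
Lemma neg_primitive_bounded (k : R) (p : nat) (zeta : R -> C) :
  0 < k -> supported_in k zeta ->
  exists A, 0 < A /\ forall (xi : R -> C) (M : R), supported_in k xi ->
    derivatives_bounded k p xi M -> derivatives_bounded k p (neg_primitive zeta xi) (A * M).
Proof.
intros Hk Hz.
destruct (smooth_derivatives_bounded k p zeta (proj1 Hz)) as [N [HN BN]].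
exists ((2 * k + 1) * (1 + 2 * k * N)); split.
{ pose proof (Rmult_lt_0_compat _ _ Hk HN); apply Rmult_lt_0_compat; lra. }
intros xi M Hx BM.
assert (M0 : 0 <= M).
{ apply Rle_trans with (1 := Cmod_ge_0 (CDerive_n xi 0 0)), BM; [rewrite Rabs_R0; lra | lia]. }
assert (BI : Cmod (integral_R xi) <= 2 * k * M).
{ rewrite (integral_R_upto k k) by (assumption || lra).
  apply Cmod_integral_upto_le; [exact Hx | rewrite Rabs_pos_eq; lra |].
  intros x q Hxk Hq; apply BM; [exact Hxk | lia]. }
pose proof (mean_free_supported k zeta xi Hz Hx) as Hm.
assert (Bm : derivatives_bounded k p (mean_free zeta xi) ((1 + 2 * k * N) * M)).
{ intros x q Hxk Hq; unfold mean_free.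
  rewrite CDerive_n_minus_scal by (apply Hx || apply Hz).
  apply Rle_trans with (1 := Cmod_triangle _ _).
  rewrite Cmod_opp, Cmod_mult.
  pose proof (BM x q Hxk Hq) as Hxq; pose proof (BN x q Hxk Hq) as Hzq.
  pose proof (Rmult_le_compat _ _ _ _ (Cmod_ge_0 _) (Cmod_ge_0 _) BI Hzq).
  lra. }
assert (P0 : 0 <= (1 + 2 * k * N) * M).
{ pose proof (Rmult_lt_0_compat _ _ Hk HN); apply Rmult_le_pos; lra. }
intros x [|q] Hxk Hq.
- rewrite CDerive_n_0.
  unfold neg_primitive; rewrite Cmod_opp.
  apply Rle_trans with (2 * k * ((1 + 2 * k * N) * M)); [|lra].
  apply Cmod_integral_upto_le; [exact Hm | exact Hxk |].
  intros y r Hy Hr; apply Bm; [exact Hy | lia].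
- unfold neg_primitive; rewrite (CDerive_n_neg_integral_upto k), Cmod_opp by exact Hm.
  apply Rle_trans with ((1 + 2 * k * N) * M); [apply Bm; [exact Hxk | lia]|].
  pose proof (Rmult_le_pos _ _ (Rlt_le _ _ Hk) P0); lra.
Qed.

Definition neg_primitive_test (E : test_space) (zeta : test E)
    (hzeta : integral_R zeta = RtoC 1) (xi : test E) : test E :=
  Test (neg_primitive_in_space E zeta xi hzeta).

Lemma neg_primitive_test_plus (E : test_space) (zeta : test E)
    (hzeta : integral_R zeta = RtoC 1) (xi eta : test E) :
  neg_primitive_test E zeta hzeta (plus xi eta)
  = plus (neg_primitive_test E zeta hzeta xi) (neg_primitive_test E zeta hzeta eta).
Proof.
apply test_ext; intros x; simpl.
destruct (common_support E xi eta) as [k [Hx He]].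
destruct (common_support E xi zeta) as [l [_ Hz]].
apply neg_primitive_plus with (Rmax k l).
- apply supported_in_le with (2 := Hz); apply Rmax_r.
- apply supported_in_le with (2 := Hx); apply Rmax_l.
- apply supported_in_le with (2 := He); apply Rmax_l.
Qed.

Lemma neg_primitive_test_scal (E : test_space) (zeta : test E)
    (hzeta : integral_R zeta = RtoC 1) (c : C) (xi : test E) :
  neg_primitive_test E zeta hzeta (scal c xi) = scal c (neg_primitive_test E zeta hzeta xi).
Proof.
apply test_ext; intros x; simpl.
destruct (common_support E xi zeta) as [k [Hx Hz]].
now apply neg_primitive_scal with k.
Qed.

Lemma neg_primitive_test_opp_deriv (E : test_space) (zeta : test E)
    (hzeta : integral_R zeta = RtoC 1) (xi : test E) :
  neg_primitive_test E zeta hzeta (opp (test_deriv xi)) = xi.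
Proof.
apply test_ext; intros x; simpl.
destruct (common_support E xi zeta) as [k [Hx Hz]].
now apply neg_primitive_opp_Derive with k.
Qed.

(** Two radii are needed because subtracting a multiple of [zeta] enlarges the
    support: a function supported in [-m, m] goes to one supported in [-k, k]. *)
Lemma trace_nbhd0_neg_primitive (E : test_space) (zeta : test E)
    (hzeta : integral_R zeta = RtoC 1)
    (k m : R) (V : test E -> Prop) :
  0 < k -> m <= k -> supported_in k zeta ->
  trace_nbhd0 k V -> trace_nbhd0 m (fun u => V (neg_primitive_test E zeta hzeta u)).
Proof.
intros Hk Hm Hz [p [eps HV]].
destruct (neg_primitive_bounded k p zeta Hk Hz) as [A [HA BA]].
assert (Hd : 0 < eps / (2 * A)).
{ apply Rdiv_lt_0_compat; [apply cond_pos | lra]. }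
(* [Rbar_lt] is strict: the factor 2 leaves room for the passage through a
   non-strict bound. *)
exists p, (mkposreal _ Hd); intros xi Hx Hxi; simpl in Hxi.
assert (Hxk : supported_in k xi) by now apply supported_in_le with m.
apply HV; [now apply neg_primitive_supported|].
apply Rbar_le_lt_trans with (A * (eps / (2 * A))).
- apply sup_norm_le, BA; [exact Hxk|].
  intros x q Hxk' Hq; destruct (Rle_or_lt (Rabs x) m) as [H|H].
  + now apply (proj1 (sup_norm_le m p xi _) (Rbar_lt_le _ _ Hxi)).
  + rewrite (supported_in_Derive_n m) by assumption; rewrite Cmod_0; lra.
- simpl; replace (A * (eps / (2 * A))) with (eps / 2) by (field; lra).
  pose proof (cond_pos eps); lra.
Qed.

(** The witness for the inductive limit is the preimage of the one given:
    linearity keeps it absolutely convex, and its trace on each step is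
    controlled on a later step that contains [zeta]. *)
Lemma nbhd0_neg_primitive (E : test_space) (zeta : test E)
    (hzeta : integral_R zeta = RtoC 1) (V : test E -> Prop) :
  nbhd0 V -> nbhd0 (fun u => V (neg_primitive_test E zeta hzeta u)).
Proof.
destruct E as [a|].
- apply trace_nbhd0_neg_primitive; [apply cond_pos | apply Rle_refl | exact (test_prop zeta)].
- intros [W [HWV [Hconv Htr]]].
  exists (fun u => W (neg_primitive_test _ zeta hzeta u)); split; [|split].
  + intros u; apply HWV.
  + intros xi eta alpha beta Hx He Hab.
    rewrite neg_primitive_test_plus, !neg_primitive_test_scal; now apply Hconv.
  + intros m Hm; destruct (test_prop zeta) as [n [Hn Hz]].
    apply trace_nbhd0_neg_primitive with (INR (Nat.max m n)).
    * apply lt_0_INR; lia.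
    * apply le_INR; lia.
    * apply supported_in_le with (2 := Hz); apply le_INR; lia.
    * apply Htr; lia.
Qed.

(** * Composition with a continuous linear map *)

(** Only the values of [f] at [T x + t T u] enter, so the multipliers [r] and [s]
    that serve [f] at [T x] and [T u] serve [f o T] at [x] and [u]. Continuity at
    [x] follows from continuity of [T] at 0 by linearity. *)
Lemma demi_distribution_comp (E : test_space) (gamma : C -> C)
    (U : test E -> Prop) (f : test E -> C) (T : test E -> test E) :
  (forall xi eta, T (plus xi eta) = plus (T xi) (T eta)) ->
  (forall (c : C) xi, T (scal c xi) = scal c (T xi)) ->
  (forall V, nbhd0 V -> nbhd0 (fun u => V (T u))) ->
  demi_distribution gamma U f ->
  demi_distribution gamma (fun u => U (T u)) (fun xi => f (T xi)).
Proof.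
intros Tplus Tscal Tcont [fcont [f0 fdemi]]; split; [|split].
- intros x P HP; pose proof (Tcont _ (fcont (T x) P HP)) as H.
  refine (eq_ind _ (nbhd0 (E := E)) H _ _).
  apply functional_extensionality; intros u; now rewrite Tplus.
- assert (Z : forall u : test E, scal (RtoC 0) u = zero)
    by (intros u; apply (scal_zero_l (V := test_ModuleSpace E))).
  assert (T0 : T zero = zero)
    by exact (eq_trans (f_equal T (eq_sym (Z zero))) (eq_trans (Tscal (RtoC 0) zero) (Z (T zero)))).
  exact (eq_trans (f_equal f T0) f0).
- intros x u t Hu Ht; rewrite Tplus, Tscal; now apply fdemi.
Qed.

Theorem theorem2p6 (E : test_space) (U : test E -> Prop) (gamma : C -> C)
    (hU : nbhd0 U) (hgamma : C0 gamma)
    (f : test E -> C) (hf : demi_distribution gamma U f)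
    (zeta : test E) (hzeta : integral_R zeta = RtoC 1) :
  exists (U_zeta : test E -> Prop) (y_zeta : test E -> C),
    nbhd0 U_zeta /\
    demi_distribution gamma U_zeta y_zeta /\
    demi_derivative y_zeta = f /\
    forall xi : test E,
      exists eta : test E,
        (forall x : R,
           eta x = (- integral_upto
                        (fun tau => xi tau - integral_R xi * zeta tau) x)%C) /\
        y_zeta xi = f eta.
Proof.
exists (fun u => U (neg_primitive_test E zeta hzeta u)),
  (fun xi => f (neg_primitive_test E zeta hzeta xi)).
split; [|split; [|split]].
- now apply nbhd0_neg_primitive.
- apply demi_distribution_comp; [apply neg_primitive_test_plus | apply neg_primitive_test_scal | | exact hf].
  intros V; apply nbhd0_neg_primitive.
- apply functional_extensionality; intros xi; unfold demi_derivative.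
  now rewrite neg_primitive_test_opp_deriv.
- intros xi; exists (neg_primitive_test E zeta hzeta xi); split; reflexivity.
Qed.
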